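(* Let $A=(a_{ij})\in\mathbb{R}^{n\times n}$ be symmetric with eigenvalues $\mu_1\ge\mu_2\ge\cdots\ge\mu_n$, and assume $0\le a_{ij}\le 1$ for all $i\ne j$ and $a_{ii}\ge 0$ for all $1\le i\le n$. Let $r\ge 2$ be an integer and $\beta_r:=\frac{r+\sqrt{r+2}}{1+\sqrt{r+2}}$. Then \[ \mu_{n-r+1}+\cdots+\mu_n\ge -\frac{\beta_r}{2}\,n . \] In particular, \[ \mu_{n-r+1}\ge -\frac{\beta_r}{2r}\,n . \] *)

(* Defs.v *)
From HB Require Import structures.
From mathcomp Require Export all_boot all_order all_algebra.
From mathcomp Require Export reals.

Set Implicit Arguments.
Unset Strict Implicit.
Unset Printing Implicit Defensive.

Import Order.TTheory GRing.Theory Num.Theory.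
Local Open Scope ring_scope.

(* [mu] lists the eigenvalues of [A] in nonincreasing order, repeated according
   to multiplicity: mu_k of the usual 1-based numbering is [mu`_(k - 1)]. *)
Definition ordered_eigenvalues (R : realType) (n : nat) (A : 'M[R]_n)
    (mu : n.-tuple R) : Prop :=
  sorted >=%R mu /\ char_poly A = \prod_(x <- mu) ('X - x%:P).

Definition beta (R : realType) (r : nat) : R :=
  (r%:R + Num.sqrt (r%:R + 2)) / (1 + Num.sqrt (r%:R + 2)).

(* Main.v *)
Require Import Defs.
From mathcomp Require Import all_boot all_order all_algebra.
From mathcomp Require Import reals.
From mathcomp Require Import ring lra.

(* The sum of the [r] smallest eigenvalues is [tr (A P)] for the orthogonal
   projection [P = V^T V] onto the span of the corresponding eigenvectors.
   The entry bounds on [A], together with [P i i >= 0] and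
   [sum_ij P i j >= 0], give [tr (A P) >= - 1/2 sum_ij |P i j|], so it suffices
   to show [sum_ij |P i j| <= beta_r n], the bound [beta_r] on the maximal
   absolute projection constant.

   Write the columns of [V] as [g_i u_i] with [u_i] a unit vector, and let
   [G_ij = <u_i, u_j>].  A quartic [a + b t^2 - c t^4] dominates [|t|] on
   [[-1, 1]].  Weighting with [g_i g_j], the second moment of [G] is at most
   [n] by AM-GM and [V V^T = 1], the fourth moment is bounded below by the Welch
   inequality [3 (sum_i g_i)^2 <= r (r + 2) sum_ij g_i g_j G_ij^4], and
   [(sum_i g_i)^2 <= n r].  These combine to exactly [beta_r n]. *)

Set Implicit Arguments.
Unset Strict Implicit.

Import Order.TTheory GRing.Theory Num.Theory.
Local Open Scope ring_scope.

(** * Orthogonal diagonalisation of symmetric matrices *)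

Lemma char_poly_similar (F : comNzRingType) (n : nat) (A P Q : 'M[F]_n) :
  P *m Q = 1%:M -> char_poly (P *m A *m Q) = char_poly A.
Proof.
move=> PQ1; rewrite /char_poly.
have -> : char_poly_mx (P *m A *m Q) =
    map_mx polyC P *m char_poly_mx A *m map_mx polyC Q.
  rewrite /char_poly_mx mulmxBr mulmxBl scalar_mxC -(mulmxA 'X%:M) -!map_mxM.
  by rewrite PQ1 map_mx1 mulmx1.
rewrite !det_mulmx mulrAC -det_mulmx -map_mxM PQ1 map_mx1.
by rewrite det1 mul1r.
Qed.

Lemma char_poly_block_diag (F : comNzRingType) (m n : nat)
    (A : 'M[F]_m) (B : 'M[F]_n) :
  char_poly (block_mx A 0 0 B) = char_poly A * char_poly B.
Proof.
rewrite /char_poly /char_poly_mx map_block_mx !map_mx0 (scalar_mx_block m n 'X).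
by rewrite opp_block_mx add_block_mx !oppr0 !addr0 det_ublock.
Qed.

Lemma mulmx_tr_gt0 (F : realDomainType) (n : nat) (v : 'rV[F]_n) :
  v != 0 -> 0 < (v *m v^T) 0 0.
Proof.
move=> v0; have ge0 i : 0 <= v 0 i * v^T i 0 by rewrite mxE -expr2 sqr_ge0.
rewrite mxE lt_def sumr_ge0 ?andbT //; apply: contra v0 => /eqP s0.
apply/eqP/rowP => i; have /eqP := psumr_eq0P (fun i _ => ge0 i) s0 (i := i) isT.
by rewrite !mxE mulf_eq0 orbb => /eqP.
Qed.

Lemma reflection_orthogonal (F : numFieldType) (n : nat) (w : 'rV[F]_n)
    (c : F) :
  c != 0 -> w *m w^T = c%:M ->
  let H := 1%:M - (2 / c) *: (w^T *m w) in H *m H^T = 1%:M.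
Proof.
move=> c0 ww H.
have HT : H^T = H by rewrite /H linearB /= linearZ /= trmx_mul trmxK trmx1.
have -> : H *m H^T = 1%:M - (2 / c) *: (w^T *m w) - (2 / c) *: (w^T *m w) +
    (2 / c) *: ((2 / c) *: (w^T *m (w *m w^T) *m w)).
  rewrite HT {1}/H mulmxBl mul1mx /H mulmxBr mulmx1 -scalemxAl -scalemxAr.
  by rewrite !mulmxA opprB addrA addrAC.
rewrite ww mul_mx_scalar -!scalemxAl !scalerA.
have -> : 2 / c * (2 / c) * c = 2 / c + 2 / c by field.
by rewrite scalerDl addrA subrK subrK.
Qed.

(* The witness is the Householder reflection exchanging [v] and the first basis
   vector. *)
Lemma orthogonal_with_first_row (F : realFieldType) (n : nat)
    (v : 'rV[F]_n.+1) :
  v *m v^T = 1%:M ->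
  exists2 H : 'M[F]_n.+1, H *m H^T = 1%:M & row 0 H = v.
Proof.
move=> v1; pose e : 'rV[F]_n.+1 := delta_mx 0 0.
have e1 : e *m e^T = 1%:M.
  by rewrite trmx_delta mul_delta_mx; apply/matrixP => i j; rewrite !mxE !ord1.
have [ev|ev] := eqVneq (e - v) 0.
  exists 1%:M; first by rewrite trmx1 mulmx1.
  by rewrite rowE mulmx1; apply/eqP; rewrite -subr_eq0 -/e ev.
set w := e - v in ev; set c := (w *m w^T) 0 0.
have c0 : c != 0 by rewrite gt_eqF // mulmx_tr_gt0.
have ww : w *m w^T = c%:M by rewrite [LHS]mx11_scalar.
(* Since [e] and [v] are unit vectors, [|e - v|^2 = 2 <e, e - v>]; hence the reflection sends [e] to
   [e - w = v]. *)
have ew : e *m w^T = (c / 2)%:M.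
  have ve : v *m e^T = e *m v^T.
    by rewrite -[LHS]trmxK trmx_mul trmxK [e *m _]mx11_scalar tr_scalar_mx.
  have : (e *m w^T) *+ 2 = c%:M.
    rewrite -ww /w linearB /= mulmxBl !mulmxBr e1 v1 ve mulr2n.
    by rewrite opprB.
  move/(congr1 (fun M : 'M[F]_1 => M 0 0)).
  rewrite mulmxnE [c%:M _ _]mxE eqxx mulr1n => <-.
  by rewrite [LHS]mx11_scalar; congr (_%:M); field.
pose H := 1%:M - (2 / c) *: (w^T *m w).
exists H; first exact: reflection_orthogonal ww.
rewrite rowE -/e /H mulmxBr mulmx1 -scalemxAr mulmxA ew mul_scalar_mx scalerA.
have -> : 2 / c * (c / 2) = 1 by field.
by rewrite scale1r /w opprB addrC subrK.
Qed.

(** Deflation: the assumed factorisation supplies an eigenvalue at each stage, and conjugating by an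
    orthogonal matrix whose first row is a unit eigenvector splits it off. Taking the roots in the
    order of [mu] makes row [i] of [Q] an eigenvector for the [i]-th entry. *)
Theorem symmetric_orthodiagonalizable (F : rcfType) (n : nat) (A : 'M[F]_n)
    (mu : seq F) :
  A^T = A -> size mu = n -> char_poly A = \prod_(x <- mu) ('X - x%:P) ->
  exists2 Q : 'M[F]_n, Q *m Q^T = 1%:M &
    Q *m A *m Q^T = diag_mx (\row_i mu`_i).
Proof.
elim: n A mu => [|n IHn] A mu symA.
  by move=> _ _; exists 1%:M; apply/matrixP => -[].
case: mu => [//|x mu] [szmu] cpA.
have : eigenvalue A x.
  by rewrite eigenvalue_root_char cpA big_cons rootM root_XsubC eqxx.
case/eigenvalueP => v0 v0A v0N0; set d := (v0 *m v0^T) 0 0.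
have d0 : 0 < d by rewrite mulmx_tr_gt0.
pose v := (Num.sqrt d)^-1 *: v0.
have vA : v *m A = x *: v by rewrite /v -scalemxAl v0A !scalerA mulrC.
have v1 : v *m v^T = 1%:M.
  rewrite /v linearZ /= -scalemxAl -scalemxAr scalerA [_ *m _]mx11_scalar -/d.
  rewrite scale_scalar_mx -invfM -expr2 sqr_sqrtr ?ltW //.
  by rewrite mulVf ?gt_eqF.
have [H HH1 Hv] := orthogonal_with_first_row v1.
have [B HAH] : exists B : 'M[F]_(1 + n), H *m A *m H^T = B by eexists.
have symB : B^T = B by rewrite -HAH !trmx_mul trmxK symA mulmxA.
(* [H H^T = 1] and [row 0 H = v] turn the eigenvector equation for [v] into the first row of [B];
   symmetry of [B] then clears its first column. *)
have rowB : row 0 B = x *: delta_mx 0 0.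
  rewrite -HAH !row_mul Hv vA -scalemxAl; congr (_ *: _).
  by rewrite -Hv -row_mul HH1 rowE mulmx1.
have B0 j : B 0 j = x *+ (j == 0).
  have /rowP/(_ j) := rowB; rewrite !mxE eqxx /= => ->.
  by rewrite mulr_natr.
have l0 : lshift n (0 : 'I_1) = (0 : 'I_n.+1) by apply: val_inj.
have defB : B = block_mx x%:M 0 0 (drsubmx B).
  rewrite -{1}(submxK B); congr block_mx.
  - apply/matrixP => i j; rewrite !ord1 !mxE eqxx.
    by rewrite l0 B0.
  - apply/matrixP => i j; rewrite !ord1 !mxE.
    by rewrite l0 B0.
  - apply/matrixP => i j; rewrite !ord1 -symB !mxE.
    by rewrite l0 B0.
have cpB : char_poly (drsubmx B) = \prod_(y <- mu) ('X - y%:P).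
  have : char_poly B = char_poly A by rewrite -HAH char_poly_similar.
  rewrite {1}defB char_poly_block_diag.
  rewrite cpA big_cons {1}/char_poly /char_poly_mx det_mx11 !mxE eqxx !mulr1n.
  by move/mulfI; apply; rewrite polyXsubC_eq0.
have symB' : (drsubmx B)^T = drsubmx B by rewrite trmx_drsub symB.
have [Q QQ1 QB] := IHn _ _ symB' szmu cpB.
pose K : 'M[F]_(1 + n) := block_mx 1%:M 0 0 Q.
have KT : K^T = block_mx 1%:M 0 0 Q^T by rewrite /K tr_block_mx !trmx0 trmx1.
have KK1 : K *m K^T = 1%:M.
  rewrite KT mulmx_block !mul0mx !mulmx0 mulmx1 QQ1 !addr0 add0r.
  by rewrite -scalar_mx_block.
exists (K *m H).
  by rewrite trmx_mul mulmxA -(mulmxA K) HH1 mulmx1.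
have -> : K *m H *m A *m (K *m H)^T = K *m B *m K^T.
  by rewrite -HAH trmx_mul !mulmxA.
have -> : K *m B *m K^T = block_mx x%:M 0 0 (Q *m drsubmx B *m Q^T).
  rewrite {1}defB KT /K !mulmx_block.
  by rewrite !(mul0mx, mulmx0, mulmx1, mul1mx, addr0, add0r).
rewrite QB; apply/matrixP => i j; rewrite !mxE.
case: splitP => i' ii'; rewrite !mxE; case: splitP => j' jj'; rewrite !mxE.
- by rewrite !ord1 ii' -!val_eqE /= ii' jj' !ord1.
- by rewrite -val_eqE /= ii' jj' !ord1.
- by rewrite -val_eqE /= ii' jj' !ord1.
- by rewrite -!val_eqE /= ii' jj' eqn_add2l.
Qed.

(** * Fourth-order tensors, the Welch inequality and the quartic majorant *)

Lemma sum_delta (F : pzRingType) (I : finType) (j : I) (f : I -> F) :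
  \sum_i f i * (i == j)%:R = f j.
Proof.
rewrite (bigD1 j) //= eqxx mulr1 big1 ?addr0 // => i /negPf ->.
by rewrite mulr0.
Qed.

Lemma sum_delta_sym (F : pzRingType) (I : finType) (j : I) (f : I -> F) :
  \sum_i f i * (j == i)%:R = f j.
Proof. by under eq_bigr do rewrite eq_sym; apply: sum_delta. Qed.

(** The isotropic symmetric 4-tensor, summed over the three pairings of the indices; it is the
    fourth moment tensor of a standard Gaussian vector. *)
Definition delta4 (F : pzRingType) (r : nat) (k l m p : 'I_r) : F :=
  (k == l)%:R * (m == p)%:R + (k == m)%:R * (l == p)%:R
    + (k == p)%:R * (l == m)%:R.

Lemma sum_mul_delta4 (F : comPzRingType) (r : nat)
    (f : 'I_r -> 'I_r -> 'I_r -> 'I_r -> F) :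
  \sum_k \sum_l \sum_m \sum_p f k l m p * delta4 F k l m p =
  \sum_k \sum_m (f k k m m + f k m k m + f k m m k).
Proof.
have E1 k : \sum_l \sum_m \sum_p f k l m p * ((k == l)%:R * (m == p)%:R) =
    \sum_m f k k m m.
  rewrite exchange_big; apply: eq_bigr => m _.
  under eq_bigr => l _ do
    (under eq_bigr => p _ do rewrite mulrA; rewrite sum_delta_sym).
  exact: sum_delta_sym.
have E2 k : \sum_l \sum_m \sum_p f k l m p * ((k == m)%:R * (l == p)%:R) =
    \sum_m f k m k m.
  apply: eq_bigr => l _.
  under eq_bigr => m _ do
    (under eq_bigr => p _ do rewrite mulrA; rewrite sum_delta_sym).
  exact: sum_delta_sym.
have E3 k : \sum_l \sum_m \sum_p f k l m p * ((k == p)%:R * (l == m)%:R) =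
    \sum_m f k m m k.
  apply: eq_bigr => l _.
  under eq_bigr => m _ do
    (under eq_bigr => p _ do rewrite [_%:R * _]mulrC mulrA;
     rewrite sum_delta_sym).
  exact: sum_delta_sym.
apply: eq_bigr => k _; rewrite !big_split -E1 -E2 -E3 -!big_split /=.
apply: eq_bigr => l _; rewrite -!big_split /=; apply: eq_bigr => m _.
by rewrite -!big_split /=; apply: eq_bigr => p _; rewrite /delta4 !mulrDr.
Qed.

Lemma sum_delta4_sqr (F : comNzRingType) (r : nat) :
  \sum_(k < r) \sum_l \sum_m \sum_p delta4 F k l m p * delta4 F k l m p =
  3 * r%:R * (r%:R + 2) :> F.
Proof.
rewrite sum_mul_delta4.
under eq_bigr => k _.
  under eq_bigr => m _.
    (* By symmetry all three terms equal [1 + 2 [m = k]]. *)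
    have -> : delta4 F k k m m + delta4 F k m k m + delta4 F k m m k =
        3 + 6 * (m == k)%:R.
      rewrite /delta4 !eqxx [k == m]eq_sym.
      by case: (m == k) => /=; ring.
    over.
  rewrite big_split /= (sum_delta k (fun=> 6)) sumr_const card_ord.
  over.
by rewrite sumr_const card_ord; ring.
Qed.

(* Expands [0 <= |W - c delta4|^2] for [W = sum_i g_i u_i^{(x)4}] at the
   minimising [c]. *)
Lemma welch_fourth_moment (F : realFieldType) (r n : nat) (g : 'I_n -> F)
    (u : 'I_r -> 'I_n -> F) :
  (0 < r)%N ->
  (forall i, g i * (\sum_k u k i ^+ 2) = g i) ->
  3 * (\sum_i g i) ^+ 2 <=
  r%:R * (r%:R + 2) *
    \sum_i \sum_j g i * g j * (\sum_k u k i * u k j) ^+ 4.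
Proof.
move=> r0 gu.
set M := \sum_i g i; set S := \sum_i \sum_j _.
pose W k l m p := \sum_i g i * u k i * u l i * u m i * u p i.
have WW : \sum_k \sum_l \sum_m \sum_p W k l m p * W k l m p = S.
  (* Each sum over one tensor index contributes a factor [G i j]; the four of them give the fourth
     power. *)
  pose a k i j := u k i * u k j; pose G i j := \sum_k a k i j.
  have step (c : 'I_n -> 'I_n -> F) :
      \sum_k \sum_i \sum_j c i j * a k i j = \sum_i \sum_j c i j * G i j.
    rewrite exchange_big; apply: eq_bigr => i _; rewrite exchange_big.
    by apply: eq_bigr => j _; rewrite mulr_sumr.
  have E1 k l m : \sum_p W k l m p * W k l m p =
      \sum_i \sum_j (g i * g j * G i j * a k i j * a l i j) * a m i j.
    transitivity (\sum_p \sum_i \sum_j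
        g i * g j * a k i j * a l i j * a m i j * a p i j).
      apply: eq_bigr => p _; rewrite big_distrlr /=.
      by apply: eq_bigr => i _; apply: eq_bigr => j _; rewrite /a; ring.
    by rewrite step; apply: eq_bigr => i _; apply: eq_bigr => j _; ring.
  have E2 k l : \sum_m \sum_p W k l m p * W k l m p =
      \sum_i \sum_j (g i * g j * G i j ^+ 2 * a k i j) * a l i j.
    under eq_bigr do rewrite E1.
    by rewrite step; apply: eq_bigr => i _; apply: eq_bigr => j _; ring.
  have E3 k : \sum_l \sum_m \sum_p W k l m p * W k l m p =
      \sum_i \sum_j (g i * g j * G i j ^+ 3) * a k i j.
    under eq_bigr do rewrite E2.
    by rewrite step; apply: eq_bigr => i _; apply: eq_bigr => j _; ring.
  under eq_bigr do rewrite E3.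
  rewrite step; apply: eq_bigr => i _; apply: eq_bigr => j _.
  by rewrite -mulrA -exprSr.
(* Each of the three pairings contracts the fourth tensor power of [u_i] to [|u_i|^4], and [gu] lets
   the weight [g i] absorb this factor. *)
have WE : \sum_k \sum_l \sum_m \sum_p W k l m p * delta4 F k l m p = 3 * M.
  rewrite sum_mul_delta4.
  have gu2 i : g i * (\sum_k \sum_m u k i ^+ 2 * u m i ^+ 2) = g i.
    by rewrite -big_distrlr mulrA !gu.
  rewrite mulr_sumr -(eq_bigr _ (fun i _ => congr1 ( *%R 3) (gu2 i))).
  under [RHS]eq_bigr => i _.
    rewrite mulrA mulr_sumr; under eq_bigr => k _ do rewrite mulr_sumr.
    over.
  rewrite [RHS]exchange_big; apply: eq_bigr => k _.
  rewrite [RHS]exchange_big; apply: eq_bigr => m _.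
  rewrite /W -!big_split; apply: eq_bigr => i _ /=; ring.
have rr : 0 < r%:R * (r%:R + 2) :> F.
  by rewrite mulr_gt0 ?addr_gt0 ?ltr0n.
(* The projection coefficient [<W, delta4> / |delta4|^2 = 3 M / (3 r (r + 2))]. *)
pose c := M / (r%:R * (r%:R + 2)).
have : 0 <= \sum_k \sum_l \sum_m \sum_p (W k l m p - c * delta4 F k l m p) ^+ 2.
  by do 4! (apply: sumr_ge0 => ? _); apply: sqr_ge0.
have -> : \sum_k \sum_l \sum_m \sum_p (W k l m p - c * delta4 F k l m p) ^+ 2 =
    S - 2 * c * (3 * M) + c ^+ 2 * (3 * r%:R * (r%:R + 2)).
  rewrite -WW -WE -sum_delta4_sqr -mulNr !mulr_sumr -!big_split /=.
  apply: eq_bigr => k _; rewrite !mulr_sumr -!big_split /=.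
  apply: eq_bigr => l _; rewrite !mulr_sumr -!big_split /=.
  apply: eq_bigr => m _; rewrite !mulr_sumr -!big_split /=.
  by apply: eq_bigr => p _; ring.
have -> : S - 2 * c * (3 * M) + c ^+ 2 * (3 * r%:R * (r%:R + 2)) =
    S - 3 * M ^+ 2 / (r%:R * (r%:R + 2)).
  rewrite /c; field.
  by move: rr; rewrite lt0r mulf_eq0 negb_or => /andP[/andP[-> ->]].
by rewrite subr_ge0 ler_pdivrMr // [_ * S]mulrC.
Qed.

(* The difference of the two sides is [(1 - |t|) (|t| - p)^2 (|t| + 1 + 2 p)],
   so equality holds exactly at [|t| = p] and [|t| = 1], the values taken by a
   maximal system of equiangular lines when [p = 1 / sqrt (r + 2)]. *)
Lemma normr_le_quartic (F : realFieldType) (p t : F) :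
  0 <= p -> `|t| <= 1 ->
  2 * p * (1 + p) ^+ 2 * `|t| <=
  p ^+ 2 * (1 + 2 * p) + (3 * p ^+ 2 + 2 * p + 1) * t ^+ 2 - t ^+ 4.
Proof.
move=> p0 t1; have t4 : t ^+ 4 = `|t| ^+ 4.
  by rewrite (exprM t 2 2) -(real_normK (num_real t)) -exprM.
rewrite t4 -(real_normK (num_real t)).
have := normr_ge0 t; move: `|t| t1 => x x1 x0.
rewrite -subr_ge0.
have -> : p ^+ 2 * (1 + 2 * p) + (3 * p ^+ 2 + 2 * p + 1) * x ^+ 2 - x ^+ 4
    - 2 * p * (1 + p) ^+ 2 * x = (1 - x) * (x - p) ^+ 2 * (x + 1 + 2 * p).
  by ring.
apply: mulr_ge0; first apply: mulr_ge0.
- by rewrite subr_ge0.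
- exact: sqr_ge0.
- lra.
Qed.

(** * Absolute entry sum of a rank [r] projection *)

(** AM-GM: once the right side is symmetrised, the difference is half the sum of
    [(g i - g j)^2 h i j]. *)
Lemma sum_mul_le_sum_sqr (F : realFieldType) (I : finType) (g : I -> F)
    (h : I -> I -> F) :
  (forall i j, 0 <= h i j) -> (forall i j, h i j = h j i) ->
  \sum_i \sum_j g i * g j * h i j <= \sum_i \sum_j g i ^+ 2 * h i j.
Proof.
move=> h0 hC; set X := \sum_i _; set Y := \sum_i _.
have YC : Y = \sum_i \sum_j g j ^+ 2 * h i j.
  rewrite /Y exchange_big; apply: eq_bigr => i _; apply: eq_bigr => j _.
  by rewrite hC.
suff : 0 <= Y + Y - 2 * X by lra.
have -> : Y + Y - 2 * X = \sum_i \sum_j (g i - g j) ^+ 2 * h i j.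
  rewrite {2}YC -mulNr mulr_sumr -!big_split /=; apply: eq_bigr => i _.
  by rewrite mulr_sumr -!big_split /=; apply: eq_bigr => j _; ring.
by do 2! (apply: sumr_ge0 => ? _); rewrite mulr_ge0 ?sqr_ge0.
Qed.

Theorem sum_norm_projection_le (R : realType) (r n : nat) (V : 'M[R]_(r, n)) :
  (2 <= r)%N -> V *m V^T = 1%:M ->
  \sum_i \sum_j `|(V^T *m V) i j| <= beta R r * n%:R.
Proof.
move=> r2 VV.
pose g i := Num.sqrt ((V^T *m V) i i).
have PE i j : (V^T *m V) i j = \sum_k V k i * V k j.
  by rewrite mxE; apply: eq_bigr => k _; rewrite mxE.
have P0 i : 0 <= (V^T *m V) i i.
  by rewrite PE sumr_ge0 // => k _; rewrite -expr2 sqr_ge0.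
have g0 i : 0 <= g i by apply: sqrtr_ge0.
have g2 i : g i ^+ 2 = \sum_k V k i ^+ 2.
  by rewrite sqr_sqrtr // PE; apply: eq_bigr => k _; rewrite expr2.
(* Division by zero makes [U] vanish on the zero columns of [V]. *)
pose U := \matrix_(k, i) (V k i / g i) : 'M[R]_(r, n).
(* The columns of [U] are unit or zero, so [q] takes only the values 1 and 0. *)
pose q i := \sum_k U k i ^+ 2; pose G i j := \sum_k U k i * U k j.
have gU k i : g i * U k i = V k i.
  rewrite mxE; have [gi0|gi0] := eqVneq (g i) 0; last by rewrite mulrC divfK.
  have := g2 i; rewrite gi0 expr0n /= => /esym s0; apply/esym/eqP.
  by rewrite mul0r -sqrf_eq0 (psumr_eq0P _ s0) // => l _; apply: sqr_ge0.
have g2q i : g i ^+ 2 * q i = g i ^+ 2.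
  by rewrite [RHS]g2 mulr_sumr; apply: eq_bigr => k _; rewrite -exprMn gU.
have gq i : g i * q i = g i.
  have [->|gi0] := eqVneq (g i) 0; first by rewrite mul0r.
  by apply: (mulfI gi0); rewrite mulrA -!expr2 g2q.
have q1 i : q i <= 1.
  have [gi0|gi0] := eqVneq (g i) 0.
    by rewrite /q big1 // => k _; rewrite mxE gi0 invr0 mulr0 expr0n.
  by rewrite le_eqVlt; apply/orP; left; apply/eqP/(mulfI gi0); rewrite gq mulr1.
have GC i j : G i j = G j i by apply: eq_bigr => k _; rewrite mulrC.
have PG i j : (V^T *m V) i j = g i * g j * G i j.
  by rewrite PE mulr_sumr; apply: eq_bigr => k _; rewrite -!gU; ring.
have G1 i j : `|G i j| <= 1.
  suff : `|G i j| <= (q i + q j) / 2.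
    by move/le_trans; apply; have := q1 i; have := q1 j; lra.
  apply: le_trans (ler_norm_sum _ _ _) _.
  rewrite ler_pdivlMr // mulr_suml -big_split /=; apply: ler_sum => k _.
  rewrite normrM -(real_normK (num_real (U k i))).
  rewrite -(real_normK (num_real (U k j))).
  have := sqr_ge0 (`|U k i| - `|U k j|); move: `|_| `|_| => x y; nra.
pose S2 := \sum_i \sum_j g i * g j * G i j ^+ 2.
pose S4 := \sum_i \sum_j g i * g j * G i j ^+ 4.
pose M := \sum_i g i.
have S2n : S2 <= n%:R.
  apply: le_trans (sum_mul_le_sum_sqr _ _ _) _ => [i j|i j|].
  - exact: sqr_ge0.
  - by rewrite GC.
  rewrite exchange_big /= -[n in n%:R]card_ord -sumr_const.
  (* The numbers [g i * G i j] are the entries of [V^T U]; since [V V^T = 1], the squares in column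
     [j] sum to [q j]. *)
  apply: ler_sum => j _; apply: le_trans (q1 j).
  have gG i : g i * G i j = (V^T *m U) i j.
    rewrite mxE mulr_sumr; apply: eq_bigr => k _.
    by rewrite mulrA gU [V^T _ _]mxE.
  have -> : q j = (U^T *m U) j j.
    by rewrite mxE; apply: eq_bigr => k _; rewrite [U^T _ _]mxE expr2.
  have -> : U^T *m U = (V^T *m U)^T *m (V^T *m U).
    by rewrite trmx_mul trmxK -mulmxA (mulmxA V) VV mul1mx.
  rewrite mxE; apply: ler_sum => i _.
  by rewrite -exprMn gG [(_^T) j i]mxE expr2.
have sg2 : \sum_i g i ^+ 2 = r%:R.
  transitivity (\tr (V^T *m V)); last by rewrite mxtrace_mulC VV mxtrace1.
  by apply: eq_bigr => i _; rewrite sqr_sqrtr.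
have M2 : M ^+ 2 <= n%:R * r%:R.
  have -> : M ^+ 2 = \sum_i \sum_j g i * g j * 1.
    by rewrite expr2 big_distrlr /=; do 2! apply: eq_bigr => ? _; rewrite mulr1.
  apply: le_trans (sum_mul_le_sum_sqr _ _ _) _ => //.
  rewrite exchange_big /=; under eq_bigr do under eq_bigr do rewrite mulr1.
  by rewrite sg2 sumr_const card_ord mulr_natl.
have S4M : 3 * M ^+ 2 <= r%:R * (r%:R + 2) * S4.
  by apply: welch_fourth_moment => //; apply: ltn_trans r2.
pose s : R := Num.sqrt (r%:R + 2); pose p := s^-1.
have rR : 2 <= r%:R :> R by rewrite (ler_nat _ 2).
have s2 : s ^+ 2 = r%:R + 2 by rewrite sqr_sqrtr //; lra.
have s0 : 0 < s by rewrite sqrtr_gt0; lra.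
have s_ge1 : 1 <= s by rewrite -sqrtr1 ler_sqrt; lra.
have p0 : 0 < p by rewrite invr_gt0.
have p1 : p <= 1 by rewrite invf_le1.
have pr : p ^+ 2 * (r%:R + 2) = 1 by rewrite -s2 -exprMn mulVf ?expr1n ?gt_eqF.
set S := \sum_i _.
have SB : 2 * p * (1 + p) ^+ 2 * S <=
    p ^+ 2 * (1 + 2 * p) * M ^+ 2 + (3 * p ^+ 2 + 2 * p + 1) * S2 - S4.
  have -> : M ^+ 2 = \sum_i \sum_j g i * g j by rewrite expr2 big_distrlr /=.
  rewrite !mulr_sumr -sumrN -!big_split /=; apply: ler_sum => i _.
  rewrite !mulr_sumr -sumrN -!big_split /=; apply: ler_sum => j _.
  rewrite PG !normrM (ger0_norm (g0 i)) (ger0_norm (g0 j)).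
  have gg : 0 <= g i * g j by apply: mulr_ge0.
  have := ler_wpM2l gg (normr_le_quartic (ltW p0) (G1 i j)).
  by congr (_ <= _); ring.
(* With [s = 1 / p] and [r = s^2 - 2], [beta_r = (1 - p) (1 + 2 p) / (p (1 + p))]. *)
have betaE : 2 * p * (1 + p) ^+ 2 * beta R r =
    2 * (1 + p) * (1 - p) * (1 + 2 * p).
  have -> : beta R r = (s ^+ 2 - 2 + s) / (1 + s) by rewrite s2 /beta -/s addrK.
  rewrite /p; field.
  by rewrite gt_eqF // gt_eqF // ltr_wpDl.
have K0 : 0 < 2 * p * (1 + p) ^+ 2.
  by rewrite mulr_gt0 ?exprn_gt0 ?mulr_gt0 // ltr_wpDl.
rewrite -(ler_pM2l K0) [leRHS]mulrA betaE; apply: le_trans SB _.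
have S4M' : 3 * p ^+ 2 * M ^+ 2 <= r%:R * S4.
  have := ler_wpM2l (sqr_ge0 p) S4M.
  have -> : p ^+ 2 * (r%:R * (r%:R + 2) * S4) =
      p ^+ 2 * (r%:R + 2) * (r%:R * S4).
    by ring.
  by rewrite pr mul1r mulrA [p ^+ 2 * 3]mulrC.
have r0 : 0 < r%:R :> R by lra.
rewrite -(ler_pM2l r0).
(* Eliminating [S4] leaves this coefficient, times [p^2], in front of [M^2]; its sign allows the
   upper bound on [M^2] to be inserted. From [r >= 2] comes [4 p^2 <= 1], so
   [r p >= r p^2 = 1 - 2 p^2 >= 1/2]. *)
have c0 : 0 <= r%:R * (1 + 2 * p) - 3.
  have pp : p ^+ 2 <= p by rewrite expr2 ger_pMl.
  have := ler_wpM2l (ltW r0) pp.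
  have : p ^+ 2 * 4 <= p ^+ 2 * (r%:R + 2).
    by apply: ler_wpM2l; [exact: sqr_ge0|lra].
  by rewrite pr; move: pr; lra.
have T1 : p ^+ 2 * (r%:R * (1 + 2 * p) - 3) * M ^+ 2 <=
    p ^+ 2 * (r%:R * (1 + 2 * p) - 3) * (n%:R * r%:R).
  by apply: ler_wpM2l => //; rewrite mulr_ge0 ?sqr_ge0.
have T2 : r%:R * (3 * p ^+ 2 + 2 * p + 1) * S2 <=
    r%:R * (3 * p ^+ 2 + 2 * p + 1) * n%:R.
  apply: ler_wpM2l => //; apply: mulr_ge0; first exact: ltW.
  by have := sqr_ge0 p; lra.
(* The residual carries the factor [1 - p^2 (r + 2)], which vanishes by the choice of [p], so the
   two bounds add up to the target exactly. *)
have -> : r%:R * (2 * (1 + p) * (1 - p) * (1 + 2 * p) * n%:R) =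
    p ^+ 2 * (r%:R * (1 + 2 * p) - 3) * (n%:R * r%:R) +
    r%:R * (3 * p ^+ 2 + 2 * p + 1) * n%:R
    + (1 - p ^+ 2 * (r%:R + 2)) * (1 + 2 * p) * r%:R * n%:R by ring.
rewrite pr subrr !mul0r addr0.
apply: le_trans (lerD T1 T2).
have -> : r%:R * (p ^+ 2 * (1 + 2 * p) * M ^+ 2 +
      (3 * p ^+ 2 + 2 * p + 1) * S2 - S4) =
    p ^+ 2 * (r%:R * (1 + 2 * p) - 3) * M ^+ 2 +
    r%:R * (3 * p ^+ 2 + 2 * p + 1) * S2 + (3 * p ^+ 2 * M ^+ 2 - r%:R * S4).
  by ring.
by rewrite gerDl subr_le0.
Qed.

(** * Transfer to the smallest eigenvalues *)

Unset Implicit Arguments.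

Theorem theorem4p1 (R : realType) (n r : nat) (A : 'M[R]_n) (mu : n.-tuple R)
    (A_sym : A^T = A)
    (mu_eig : ordered_eigenvalues A mu)
    (A_offdiag : forall i j : 'I_n, i != j -> 0 <= A i j <= 1)
    (A_diag : forall i : 'I_n, 0 <= A i i)
    (r_ge2 : (2 <= r)%N) (r_len : (r <= n)%N) :
  \sum_(n - r <= k < n) mu`_k >= - (beta R r / 2) * n%:R
  /\ mu`_(n - r) >= - (beta R r / (2 * r%:R)) * n%:R.
Proof.
case: mu_eig => mu_sorted cpA.
have [Q QQ QA] := symmetric_orthodiagonalizable A_sym (size_tuple mu) cpA.
(* Indices are 0-based and [mu] is nonincreasing, so the [r] smallest eigenvalues sit at
   [n - r, ..., n - 1]; [V] keeps those rows of [Q]. *)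
have f_lt (k : 'I_r) : (k + (n - r) < n)%N.
  by rewrite -[ltnRHS](subnKC r_len) ltn_add2r.
pose f k := Ordinal (f_lt k); pose V := rowsub f Q.
have f_inj : injective f.
  by move=> k l /(congr1 val)/eqP /=; rewrite eqn_add2r => /eqP/val_inj.
have VV : V *m V^T = 1%:M.
  rewrite /V trmx_mxsub -mxsub_mul QQ; apply/matrixP => k l.
  by rewrite !mxE (inj_eq f_inj).
have sumE : \sum_(n - r <= k < n) mu`_k = \sum_(k < r) mu`_(k + (n - r)).
  by rewrite -{1}[(n - r)%N]add0n big_addn subKn // big_mkord.
have trE : \sum_(k < r) mu`_(k + (n - r)) =
    \sum_i \sum_j A i j * (V^T *m V) i j.
  transitivity (\tr (V *m A *m V^T)).
    apply: eq_bigr => k _.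
    have -> : V *m A *m V^T = mxsub f f (Q *m A *m Q^T).
      by rewrite /V trmx_mxsub mul_rowsub_mx -mxsub_mul.
    by rewrite QA !mxE eqxx.
  rewrite -mulmxA mxtrace_mulC -mulmxA; apply: eq_bigr => i _.
  rewrite mxE; apply: eq_bigr => j _; congr (_ * _).
  by rewrite !mxE; apply: eq_bigr => k _; rewrite !mxE mulrC.
(* With [1] the all-ones vector, the sum is [1^T V^T V 1 = |V 1|^2]. *)
have sumP : 0 <= \sum_i \sum_j (V^T *m V) i j.
  have -> : \sum_i \sum_j (V^T *m V) i j = \sum_k (\sum_i V k i) ^+ 2.
    under [RHS]eq_bigr do rewrite expr2 big_distrlr /=.
    rewrite [RHS]exchange_big; apply: eq_bigr => i _.
    rewrite [RHS]exchange_big; apply: eq_bigr => j _.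
    by rewrite mxE; apply: eq_bigr => k _; rewrite [V^T _ _]mxE.
  by apply: sumr_ge0 => k _; apply: sqr_ge0.
(* For [0 <= a <= 1], [a x >= min (x, 0) = (x - |x|) / 2]; on the diagonal the left side is 0
   because [V^T V] has nonnegative diagonal. *)
have AP i j :
    ((V^T *m V) i j - `|(V^T *m V) i j|) / 2 <= A i j * (V^T *m V) i j.
  have [<-|ij] := eqVneq i j.
    have P0 : 0 <= (V^T *m V) i i.
      by rewrite mxE sumr_ge0 // => k _; rewrite [V^T _ _]mxE -expr2 sqr_ge0.
    by rewrite ger0_norm // subrr mul0r mulr_ge0.
  have /andP[a0 a1] := A_offdiag i j ij.
  case: (ger0P ((V^T *m V) i j)) => P0; first by rewrite subrr mul0r mulr_ge0.
  by nra.
have bound : - (beta R r / 2) * n%:R <= \sum_(n - r <= k < n) mu`_k.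
  have SB := sum_norm_projection_le r_ge2 VV.
  have : (\sum_i \sum_j (V^T *m V) i j - \sum_i \sum_j `|(V^T *m V) i j|) / 2 <=
      \sum_(n - r <= k < n) mu`_k.
    rewrite sumE trE -sumrB mulr_suml; apply: ler_sum => i _.
    by rewrite -sumrB mulr_suml; apply: ler_sum => j _.
  by lra.
split=> //.
have r0 : 0 < r%:R :> R by rewrite ltr0n; apply: ltn_trans r_ge2.
(* The entry at [n - r] is the largest of the [r] summands. *)
have : \sum_(n - r <= k < n) mu`_k <= r%:R * mu`_(n - r).
  rewrite sumE mulr_natl -[r in _ *+ r]card_ord -sumr_const.
  apply: ler_sum => k _.
  apply: (sorted_leq_nth (@ge_trans _ R) (@ge_refl _ R) 0 mu_sorted).
  - rewrite inE size_tuple; exact: leq_ltn_trans (leq_addl k _) (f_lt k).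
  - by rewrite inE size_tuple.
  - exact: leq_addl.
move/(le_trans bound); rewrite -ler_pdivrMl //.
by congr (_ <= _); field; rewrite gt_eqF.
Qed.
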